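(* Let $N \ge 3$ and let $\mathbf{A} \in \mathbb{R}^{N\times N}$ be the circulant matrix with $-2$ on the diagonal, with entry $1$ at every position $(j,k)$ with $j-k \equiv \pm 1 \pmod N$, and with all other entries $0$. Then the Moore-Penrose inverse $\mathbf{A}^+$ of $\mathbf{A}$ is a symmetric matrix of the form $\mathbf{A}^+ = \mathrm{circ}(a_0^+, a_1^+, \ldots, a_{N-1}^+)$, where $$a_j^+ = \frac{1}{12N}(1-N^2) + \frac{1}{2N}\, j(N-j), \qquad j = 0,\ldots,N-1.$$
   Context: Rows and columns are indexed by $0,\ldots,N-1$. The notation $\mathrm{circ}(a_0,\ldots,a_{N-1})$ denotes the circulant $N\times N$ matrix with first column $(a_0,\ldots,a_{N-1})^T$, i.e. whose $(j,k)$ entry is $a_{(j-k) \bmod N}$. The Moore-Penrose inverse of a real square matrix $\mathbf{L}$ is the unique matrix $\mathbf{L}^+$ such that $\mathbf{L}\mathbf{L}^+\mathbf{L} = \mathbf{L}$, $\mathbf{L}^+\mathbf{L}\mathbf{L}^+ = \mathbf{L}^+$, and both $\mathbf{L}\mathbf{L}^+$ and $\mathbf{L}^+\mathbf{L}$ are symmetric. *)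

(* Defs.v *)
From mathcomp Require Import all_boot all_order all_algebra.
From mathcomp Require Import boolp classical_sets reals.

Set Implicit Arguments.
Unset Strict Implicit.
Unset Printing Implicit Defensive.

Import Order.TTheory GRing.Theory Num.Theory.
Local Open Scope ring_scope.

(* circ(a_0, ..., a_(N-1)). The sum j + (N - k) is j - k mod N computed in nat
   without truncation, since k < N; only a 0, ..., a (N - 1) are used. *)
Definition circ (R : realType) (N : nat) (a : nat -> R) : 'M[R]_N :=
  \matrix_(j < N, k < N) a ((j + (N - k)) %% N)%N.

Definition is_moore_penrose (R : realType) (n : nat) (L X : 'M[R]_n) : Prop :=
  [/\ L *m X *m L = L,
      X *m L *m X = X,
      (L *m X)^T = L *m X
    & (X *m L)^T = X *m L].

Lemma moore_penrose_unique (R : realType) (n : nat) (L X Y : 'M[R]_n) :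
  is_moore_penrose L X -> is_moore_penrose L Y -> X = Y.
Proof.
move=> [x1 x2 x3 x4] [y1 y2 y3 y4].
have e1 : L *m X = L *m Y.
  by rewrite -x3 -{1}y1 -mulmxA trmx_mul x3 y3 mulmxA x1.
have e2 : X *m L = Y *m L.
  by rewrite -x4 -{1}y1 -mulmxA mulmxA trmx_mul y4 x4 -mulmxA (mulmxA L) x1.
by rewrite -x2 e2 -mulmxA e1 mulmxA y2.
Qed.

Lemma gram_unit (R : realType) (m n : nat) (F : 'M[R]_(m, n)) :
  row_free F -> F *m F^T \in unitmx.
Proof.
move=> Ffree; rewrite -row_free_unit; apply/row_freeP.
suff K0 : kermx (F *m F^T) = 0.
  by apply/row_freeP; rewrite -kermx_eq0 K0.
set K := kermx _.
have H : (K *m F) *m (K *m F)^T = 0.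
  by rewrite trmx_mul mulmxA -(mulmxA K) mulmx_ker mul0mx.
have KF0 : K *m F = 0.
  apply/matrixP=> i j; rewrite [RHS]mxE.
  have := congr1 (fun M : 'M_m => M i i) H; rewrite mxE [RHS]mxE => /eqP.
  rewrite psumr_eq0; last by move=> k _; rewrite [_^T _ _]mxE -expr2 sqr_ge0.
  move=> /allP/(_ j (mem_index_enum j)) /=.
  by rewrite [_^T _ _]mxE -expr2 sqrf_eq0 => /eqP.
by apply: (row_free_inj Ffree); rewrite KF0 mul0mx.
Qed.

Lemma moore_penrose_exists (R : realType) (n : nat) (L : 'M[R]_n) :
  exists X, is_moore_penrose L X.
Proof.
have [r [C [F [LCF uF uC]]]] : exists r (C : 'M[R]_(n, r)) (F : 'M[R]_(r, n)),
    [/\ L = C *m F, F *m F^T \in unitmx & C^T *m C \in unitmx].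
  exists (\rank L), (col_base L), (row_base L); split.
  - by rewrite mulmx_base.
  - exact/gram_unit/row_base_free.
  - rewrite -[X in _ *m X]trmxK; apply: gram_unit.
    by rewrite /row_free mxrank_tr -/(row_full _) col_base_full.
pose G := invmx (F *m F^T); pose H := invmx (C^T *m C).
have GT : G^T = G by rewrite trmx_inv trmx_mul trmxK.
have HT : H^T = H by rewrite trmx_inv trmx_mul trmxK.
have FG : F *m (F^T *m G) = 1%:M by rewrite mulmxA mulmxV.
have HC : H *m C^T *m C = 1%:M by rewrite -mulmxA mulVmx.
have LX : L *m (F^T *m G *m (H *m C^T)) = C *m (H *m C^T).
  by rewrite LCF -mulmxA (mulmxA F) FG mul1mx.
have XL : F^T *m G *m (H *m C^T) *m L = F^T *m G *m F.
  by rewrite LCF -mulmxA (mulmxA _ C) HC mul1mx.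
exists (F^T *m G *m (H *m C^T)); split.
- by rewrite LX LCF -mulmxA (mulmxA _ C) HC mul1mx.
- by rewrite XL -mulmxA (mulmxA F) FG mul1mx.
- by rewrite LX !trmx_mul trmxK HT mulmxA.
- by rewrite XL !trmx_mul trmxK GT mulmxA.
Qed.

(* The definite description is justified by [moore_penrose_exists] and
   [moore_penrose_unique]; the default value 0 is never used. *)
Definition moore_penrose (R : realType) (n : nat) (L : 'M[R]_n) : 'M[R]_n :=
  xget 0 [set X | is_moore_penrose L X]%classic.

Lemma moore_penroseP (R : realType) (n : nat) (L : 'M[R]_n) :
  is_moore_penrose L (moore_penrose L).
Proof.
have [X LX] := moore_penrose_exists L.
exact: (@xgetPex _ 0 [set X | is_moore_penrose L X]%classic (ex_intro _ X LX)).
Qed.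

Definition matrixA (R : realType) (N : nat) : 'M[R]_N :=
  \matrix_(j < N, k < N)
    if j == k then - 2
    else if (j == k + 1 %[mod N])%N || (j + 1 == k %[mod N])%N then 1
    else 0.

Definition a_plus (R : realType) (N j : nat) : R :=
  1 / (12 * N%:R) * (1 - N%:R ^+ 2) + 1 / (2 * N%:R) * (j%:R * (N%:R - j%:R)).

(* Main.v *)
Require Import Defs.
From mathcomp Require Import all_boot all_order all_algebra.
From mathcomp Require Import reals.
From mathcomp Require Import ring.

Import Order.TTheory GRing.Theory Num.Theory.

(* Let J be the all-ones matrix and X the claimed inverse. The N-periodic
   extension of a_plus has second difference -1/N away from 0 and 1 - 1/N at 0,
   so A X = 1 - J / N. The rows of A and the columns of X sum to 0, that is
   A J = J X = 0. As A, X and A X are symmetric, X A = (A X)^T = A X, and the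
   four Penrose equations follow. *)

Local Open Scope ring_scope.

(** The factor [j * (N - j)] vanishes at both [j = 0] and [j = N], so the formula survives a
    wrap-around at [m = N]. *)
Lemma a_plus_modn (R : realType) (N m : nat) :
  (m <= N)%N -> a_plus R N (m %% N) = a_plus R N m.
Proof.
rewrite leq_eqVlt => /predU1P[->|/modn_small -> //].
by rewrite modnn /a_plus; ring.
Qed.

Lemma a_plus_sub (R : realType) (N m : nat) :
  (m <= N)%N -> a_plus R N (N - m) = a_plus R N m.
Proof. by move=> mN; rewrite /a_plus natrB //; ring. Qed.

Lemma a_plus_second_diff (R : realType) (N m : nat) : (0 < N)%N ->
  a_plus R N m + a_plus R N m.+2 - 2 * a_plus R N m.+1 = - N%:R^-1.
Proof.
move=> N0; have Nn : N%:R != 0 :> R by rewrite pnatr_eq0 -lt0n.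
by rewrite /a_plus -(addn1 m.+1) -(addn1 m) !natrD; field.
Qed.

Lemma a_plus_second_diff0 (R : realType) (N : nat) : (0 < N)%N ->
  a_plus R N N.-1 + a_plus R N 1 - 2 * a_plus R N 0 = 1 - N%:R^-1.
Proof.
case: N => // n _.
have Nn : n.+1%:R != 0 :> R by rewrite pnatr_eq0.
rewrite /a_plus /=; rewrite -(addn1 n) natrD in Nn *; by field.
Qed.

(** The constant term of [a_plus] is minus the mean of its quadratic part. *)
Lemma sum_a_plus (R : realType) (N : nat) : (0 < N)%N ->
  \sum_(i < N) a_plus R N i = 0.
Proof.
move=> N0; have Nn : N%:R != 0 :> R by rewrite pnatr_eq0 -lt0n.
(* Induction needs an upper bound [m] independent of [N]; the closed form comes from the sums of [i]
   and of [i ^ 2] over [i < m]. *)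
have partial m : \sum_(i < m) a_plus R N i =
    m%:R / (12 * N%:R) * (1 - N%:R ^+ 2)
    + (3 * N%:R * m%:R * (m%:R - 1) - (m%:R - 1) * m%:R * (2 * m%:R - 1))
      / (12 * N%:R) :> R.
  elim: m => [|m IHm]; first by rewrite big_ord0; field.
  by rewrite big_ord_recr /= IHm /a_plus -(addn1 m) natrD; field.
by rewrite partial; field.
Qed.

(** Ordinals below [n.+1] form the group of integers mod [n.+1], so later index shifts become group
    arithmetic. *)
Lemma circE (R : realType) (n : nat) (a : nat -> R) (j k : 'I_n.+1) :
  circ n.+1 a j k = a (j - k)%R.
Proof. by rewrite mxE /= modnDmr. Qed.

Lemma matrixAE (R : realType) (n : nat) (j k : 'I_n.+3) :
  matrixA R n.+3 j k
  = (k == j - 1)%:R + (k == j + 1)%:R - 2 * (k == j)%:R.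
Proof.
have jk1 : (j == k + 1 %[mod n.+3])%N = (k == j - 1).
  by rewrite [RHS]eq_sym subr_eq -val_eqE /= (modn_small (ltn_ord j)).
have kj1 : (j + 1 == k %[mod n.+3])%N = (k == j + 1).
  by rewrite [RHS]eq_sym -val_eqE /= (modn_small (ltn_ord k)).
(* Size at least 3 makes [j - 1], [j] and [j + 1] distinct, so the indicators never overlap. *)
have one0 : (1 : 'I_n.+3) != 0 by [].
have two0 : (1 + 1 : 'I_n.+3) != 0 by [].
rewrite mxE jk1 kj1 (eq_sym j k); have [->|kj] := eqVneq k j.
  have -> : (j == j - 1) = false.
    by rewrite -subr_eq0 opprB addrC subrK (negPf one0).
  have -> : (j == j + 1) = false.
    by rewrite eq_sym -subr_eq0 addrC addKr (negPf one0).
  by rewrite /=; ring.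
have [->|_] /= := eqVneq k (j - 1); last by case: (k == _) => /=; ring.
have -> : (j - 1 == j + 1) = false.
  by rewrite (inj_eq (addrI j)) eq_sym -subr_eq0 opprK (negPf two0).
by rewrite /=; ring.
Qed.

Lemma matrixA_sym (R : realType) (n : nat) :
  (matrixA R n.+3)^T = matrixA R n.+3.
Proof.
apply/matrixP => j k; rewrite mxE !matrixAE.
rewrite (eq_sym j k) (eq_sym j (k - 1)) subr_eq -(subr_eq j) (eq_sym (j - 1)).
by rewrite [X in X - _]addrC.
Qed.

Lemma circ_a_plus_sym (R : realType) (n : nat) :
  (circ n.+1 (a_plus R n.+1))^T = circ n.+1 (a_plus R n.+1).
Proof.
apply/matrixP => j k; rewrite mxE !circE -(opprB j k).
(* The value of [- i] is [n.+1 - i] reduced mod [n.+1]; the reduction matters only at [i = 0]. *)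
by move: (j - k) => i /=; rewrite a_plus_modn ?leq_subr // a_plus_sub // ltnW.
Qed.

(** [matrixA] acts on each column as the cyclic second difference. *)
Lemma mulmx_matrixA (R : realType) (n m : nat) (X : 'M[R]_(n.+3, m)) j k :
  (matrixA R n.+3 *m X) j k = X (j - 1) k + X (j + 1) k - 2 * X j k.
Proof.
have pick c : \sum_l (l == c)%:R * X l k = X c k.
  rewrite (bigD1 c) //= eqxx mul1r big1 ?addr0 // => l /negPf ->.
  by rewrite mul0r.
rewrite mxE -!pick mulr_sumr -big_split -sumrB; apply: eq_bigr => l _ /=.
by rewrite matrixAE; ring.
Qed.

Lemma matrixA_mul_circ (R : realType) (n : nat) :
  matrixA R n.+3 *m circ n.+3 (a_plus R n.+3)
  = 1%:M - const_mx n.+3%:R^-1.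
Proof.
apply/matrixP => j k; rewrite mulmx_matrixA !circE !mxE.
rewrite (addrAC j (-1)) (addrAC j 1) -(subr_eq0 j k).
(* Both sides depend only on [j - k]; the value 0 is the diagonal case. *)
move: (j - k) => [[|m] mN].
  rewrite [X in _ = X%:R - _]/=; rewrite -a_plus_second_diff0 //=.
  by rewrite !modn_small.
rewrite sub0r -(a_plus_second_diff R n.+3 m) //=.
congr (a_plus _ _ _ + _ - _).
  by rewrite (modn_small (m := 1)) // (modn_small (m := _ - 1)) // subn1
             addSnnS modnDr modn_small // ltnW.
(* Here [m.+2] may equal [n.+3], where the index wraps to 0. *)
by rewrite (modn_small (m := 1)) // addn1 a_plus_modn.
Qed.

Lemma mul_const_circ_a_plus (R : realType) (n : nat) (c : R) :
  (const_mx c : 'M_n.+1) *m circ n.+1 (a_plus R n.+1) = 0.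
Proof.
apply/matrixP => j k; rewrite !mxE.
under eq_bigr do rewrite mxE circE.
(* Shifting the summation index by [k] turns the sum of column [k] into the sum of all [a_plus]
   values. *)
rewrite -mulr_sumr (reindex_inj (addIr k)) /=.
under eq_bigr do rewrite -[modn _ _]/(val (_ + _ - k)) addrK.
by rewrite sum_a_plus // mulr0.
Qed.

Lemma matrixA_mul_const (R : realType) (n : nat) (c : R) :
  matrixA R n.+3 *m (const_mx c : 'M_n.+3) = 0.
Proof. by apply/matrixP => j k; rewrite mulmx_matrixA !mxE; ring. Qed.

Lemma circ_a_plus_is_moore_penrose (R : realType) (n : nat) :
  is_moore_penrose (matrixA R n.+3) (circ n.+3 (a_plus R n.+3)).
Proof.
have AX := @matrixA_mul_circ R n.
have P_sym : (1%:M - const_mx n.+3%:R^-1 : 'M[R]_n.+3)^T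
             = 1%:M - const_mx n.+3%:R^-1.
  by rewrite linearB /= trmx1 trmx_const.
have XA : circ n.+3 (a_plus R n.+3) *m matrixA R n.+3
          = 1%:M - const_mx n.+3%:R^-1.
  by rewrite -[LHS]trmxK trmx_mul matrixA_sym circ_a_plus_sym AX.
split; rewrite ?AX ?XA //.
(* Regrouping as A (X A) puts the constant matrix to the right of A, where A J = 0 applies. *)
- by rewrite -AX -mulmxA XA mulmxBr mulmx1 matrixA_mul_const subr0.
- by rewrite mulmxBl mul1mx mul_const_circ_a_plus subr0.
Qed.

Theorem theorem2p2 (R : realType) (N : nat) (hN : (3 <= N)%N) :
  (moore_penrose (matrixA R N))^T = moore_penrose (matrixA R N) /\
  moore_penrose (matrixA R N) = circ N (a_plus R N).
Proof.
have -> : moore_penrose (matrixA R N) = circ N (a_plus R N).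
  case: N hN => [|[|[|n]]] // _.
  exact: moore_penrose_unique (moore_penroseP _)
                              (circ_a_plus_is_moore_penrose R n).
by split=> //; case: N hN => // n _; apply: circ_a_plus_sym.
Qed.
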